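(* Let $q$ be a prime power, let $W$ be a finite nonempty subset of an $\mathbb{F}_q$-vector space, let $X\subseteq\mathbb{F}_q$ be a set of scalars, let $F$ be the subfield of $\mathbb{F}_q$ generated by $X$, and let $K_1,K_2,K_3$ be real numbers. If \begin{enumerate} \item $|W+XW|\le K_1|W|$, \item $|W+W|\le K_2|W|$, \item $|W+xW|\le K_3|W|$ for all $x\in X$, and \item $K_1^4K_2K_3^4<|X|$, \end{enumerate} then \[ |W|\ \ge\ \frac{1}{2K_1^2K_3^2}\,|\mathrm{span}_F(W)|. \]
   Context: $\mathbb{F}_q$ is the finite field with $q$ elements. $XW=\{xw:x\in X,w\in W\}$, $xW=\{xw: w\in W\}$, and $S+T=\{s+t:s\in S,t\in T\}$. $\mathrm{span}_F(W)$ is the vector space over $F$ spanned by $W$. *)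

(* Defs.v *)
From HB Require Import structures.
From mathcomp Require Import all_boot all_order all_algebra finmap.
From mathcomp Require Import boolp reals.

Set Implicit Arguments.
Unset Strict Implicit.
Unset Printing Implicit Defensive.

Import GRing.Theory.
Local Open Scope fset_scope.
Local Open Scope ring_scope.

Definition sumset (V : zmodType) (S T : {fset V}) : {fset V} :=
  [fset s + t | s in S, t in T].

Definition scale_set (K : finFieldType) (V : lmodType K)
    (X : {set K}) (W : {fset V}) : {fset V} :=
  [fset x *: w | x in X, w in W].

Definition dilate (K : finFieldType) (V : lmodType K)
    (x : K) (W : {fset V}) : {fset V} :=
  [fset x *: w | w in W].

(* Since 0^-1 = 0, divring_closed (closure under 1, subtraction and total
   division) holds of a subset of a field exactly when it is a subfield. *)
Definition generated_subfield (K : finFieldType) (X : {set K}) : {set K} :=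
  \bigcap_(S : {set K} | (X \subset S) && `[< GRing.divring_closed S >]) S.

(* Finite because both the scalars and W are. *)
Definition span_over (K : finFieldType) (V : lmodType K)
    (F : {set K}) (W : {fset V}) : {fset V} :=
  [fset \sum_(w : W) c w *: val w
    | c : {ffun W -> K} in ffun_on (mem F)].

(* Main.v *)
(* Call v a quotient if (x1 - x2) v = w1 - w2 for some wi in W and distinct xi in
   X, that is, if (w, x) |-> w + x v is not injective on W x X.  The quotients
   form all of span_F(W): they contain 0, and they are closed under adding
   elements of W and under scaling by elements of X, because for v a quotient
   and uniform independent w, x the Shannon entropies of w + x (v + u) and
   w + x (s v) are at most log(K1^4 K3^2 |W|) and log(K1^2 K3^4 |W|), hence less
   than log(|W||X|).  Entropies replace cardinalities because for them the
   inequalities of Ruzsa and Pluennecke hold with constant 1 on W itself, without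
   passing to a subset.  Finally w + x v has entropy at most log(M |W|) for every
   quotient v, with M = K1^2 K3^2, so its collision number is at least
   |W||X|^2 / M; averaging collision numbers over v in the span gives
   |span| (|X| - M) <= M |W| (|X| - 1), and |X| > M^2 >= 2 M - 1. *)
Require Import Defs.
From HB Require Import structures.
From mathcomp Require Import all_boot all_order all_algebra finmap.
From mathcomp Require Import boolp reals exp.
From mathcomp Require Import ring lra.

Set Implicit Arguments.
Unset Strict Implicit.
Unset Printing Implicit Defensive.

Import Order.TTheory GRing.Theory Num.Theory.
Local Open Scope fset_scope.
Local Open Scope ring_scope.

(** * Entropy of functions on a finite uniform space *)

Section Entropy.
Context (R : realType) (Om : finType).
Hypothesis Om_gt0 : (0 < #|Om|)%N.

Definition fiber (T : eqType) (f : Om -> T) (a : Om) : nat :=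
  #|[pred b | f b == f a]|.

Definition joint (S T : Type) (f : Om -> S) (g : Om -> T) : Om -> S * T :=
  fun a => (f a, g a).

(** Shannon entropy, in nats, of [f] at a uniform point: the value [f a] has probability [fiber f a]
    over [#|Om|]. Averaging over points rather than values lets [T] be infinite. *)
Definition entropy (T : eqType) (f : Om -> T) : R :=
  ln #|Om|%:R - (\sum_a ln (fiber f a)%:R) / #|Om|%:R.

Lemma fiber_gt0 (T : eqType) (f : Om -> T) a : (0 < fiber f a)%N.
Proof. by apply/card_gt0P; exists a; rewrite inE. Qed.

Lemma fiberE (T : eqType) (f : Om -> T) a :
  (fiber f a)%:R = \sum_b (f b == f a)%:R :> R.
Proof.
rewrite /fiber -sum1_card natr_sum big_mkcond /=; apply: eq_bigr => b _.
by rewrite inE; case: eqP.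
Qed.

Lemma eq_fiber (T : eqType) (f : Om -> T) a b : f a = f b -> fiber f a = fiber f b.
Proof. by move=> e; apply: eq_card => c; rewrite !inE e. Qed.

(** Jensen's inequality for ln, from the tangent bound ln t <= t - 1 at t = [f a / c]. *)
Lemma sum_ln_le (f : Om -> R) (c : R) :
  (forall a, 0 < f a) -> 0 < c -> \sum_a f a <= c * #|Om|%:R ->
  \sum_a ln (f a) <= #|Om|%:R * ln c.
Proof.
move=> f0 c0 fc.
have ub a : ln (f a) <= f a / c - 1 + ln c.
  have fc0 : 0 < f a / c by rewrite divr_gt0.
  have -> : ln (f a) = ln (f a / c) + ln c by rewrite -lnM ?posrE // divfK ?gt_eqF.
  rewrite lerD2r -{1}(subrK 1 (f a / c)) addrC; apply: le_ln1Dx.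
  by rewrite ltrBrDl subrr.
apply: le_trans (ler_sum _ (fun a _ => ub a)) _.
rewrite big_split /= sumr_const mulr_natl gerDr sumrB -mulr_suml sumr_const.
by rewrite subr_le0 ler_pdivrMr // mulrC.
Qed.

Lemma entropy_sum (T : eqType) (f : Om -> T) :
  #|Om|%:R * entropy f = \sum_a ln (#|Om|%:R / (fiber f a)%:R).
Proof.
have n0 : #|Om|%:R != 0 :> R by rewrite pnatr_eq0 -lt0n.
rewrite /entropy mulrBr mulrCA divff // mulr1 mulr_natl -sumr_const -sumrB.
by apply: eq_bigr => a _; rewrite ln_div // posrE ltr0n // fiber_gt0.
Qed.

(** Here [f] is a function of [g], so each fibre of [g] lies inside a fibre of [f]. *)
Lemma entropy_mono (S T : eqType) (f : Om -> S) (g : Om -> T) :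
  (forall a b, g a = g b -> f a = f b) -> entropy f <= entropy g.
Proof.
move=> fg; rewrite lerD2l lerN2; apply: ler_wpM2r; first by rewrite invr_ge0.
apply: ler_sum => a _; rewrite ler_ln ?posrE ?ltr0n ?fiber_gt0 // ler_nat.
by apply: subset_leq_card; apply/subsetP => b; rewrite !inE => /eqP/fg ->.
Qed.

Lemma entropy_inj (T : eqType) (f : Om -> T) : injective f -> entropy f = ln #|Om|%:R.
Proof.
move=> fi; rewrite /entropy big1 ?mul0r ?subr0 // => a _.
rewrite (_ : fiber f a = 1%N) ?ln1 // /fiber (eq_card (B := pred1 a)) ?card1 //.
by move=> b; rewrite !inE (inj_eq fi).
Qed.

Lemma entropy_le_ln (T : eqType) (f : Om -> T) (s : seq T) :
  (forall a, f a \in s) -> entropy f <= ln (size s)%:R.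
Proof.
move=> fs.
have n0 : 0 < #|Om|%:R :> R by rewrite ltr0n.
have s0 : (0 < size s)%N by case/card_gt0P: Om_gt0 => a _; case: (s) (fs a).
rewrite -(ler_pM2l n0) entropy_sum; apply: sum_ln_le; rewrite ?ltr0n //.
  by move=> a; rewrite divr_gt0 ?ltr0n ?fiber_gt0.
rewrite -mulr_sumr mulrC ler_pM2r //.
(* Each attained value contributes exactly 1, so the inverse fibre sizes sum to the number of
   values. *)
pose F t := \sum_(a | f a == t) (fiber f a)%:R^-1 : R.
have F1 t : F t <= 1.
  case: (pickP (fun a => f a == t)) => [a /eqP at_|no]; last by rewrite /F big_pred0.
  rewrite /F (eq_bigr (fun=> (fiber f a)%:R^-1)); last first.
    by move=> b /eqP bt; rewrite (@eq_fiber _ f b a) // bt at_.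
  rewrite sumr_const -at_ -[X in X *+ _]mulr1 -mulrnAr mulVf //.
  by rewrite pnatr_eq0 -lt0n fiber_gt0.
apply: (@le_trans _ _ (\sum_(t <- undup s) F t)); last first.
  apply: le_trans (ler_sum _ (fun t _ => F1 t)) _.
  by rewrite big_const_seq count_predT iter_addr addr0 ler_nat size_undup.
rewrite /F (exchange_big_dep xpredT) //=; apply: ler_sum => a _.
rewrite big_mkcond (bigD1_seq (f a)) ?undup_uniq ?mem_undup //= eqxx.
by rewrite lerDl sumr_ge0 // => t _; case: ifP => // _; rewrite invr_ge0.
Qed.

(* The fibre ratio below has mean at most 1; then apply Jensen. *)
Lemma entropy_submod (S T U : eqType) (f : Om -> S) (g : Om -> T) (h : Om -> U) :
  entropy (joint f (joint g h)) + entropy h <=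
  entropy (joint f h) + entropy (joint g h).
Proof.
pose p := joint f (joint g h); pose q := joint f h; pose r := joint g h.
have n0 : 0 < #|Om|%:R :> R by rewrite ltr0n.
have pos (V : eqType) (k : Om -> V) a : 0 < (fiber k a)%:R :> R.
  by rewrite ltr0n fiber_gt0.
pose rat a : R := (fiber q a)%:R * (fiber r a)%:R / ((fiber p a)%:R * (fiber h a)%:R).
suff: \sum_a rat a <= 1 * #|Om|%:R.
  have rat0 a : 0 < rat a by rewrite divr_gt0 ?mulr_gt0.
  move/(sum_ln_le rat0 ltr01); rewrite ln1 mulr0.
  under eq_bigr do rewrite ln_div ?posrE ?mulr_gt0 // !lnM ?posrE //.
  rewrite sumrB !big_split /= /entropy => le0.
  rewrite -/p -/q -/r -subr_ge0.
  set P := \sum_a ln (fiber p a)%:R; set Q := \sum_a ln (fiber q a)%:R.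
  set A := \sum_a ln (fiber r a)%:R; set B := \sum_a ln (fiber h a)%:R.
  rewrite (_ : _ - _ = (P + B - (Q + A)) / #|Om|%:R); last by field; rewrite gt_eqF.
  by apply: divr_ge0; rewrite ?ler0n // subr_ge0 -subr_le0.
rewrite mul1r.
(* Both fibre sizes in the numerator of [rat a] are expanded as sums over b and c, so that the sum
   over a can be taken first. *)
pose G (a b c : Om) : R :=
  ((f b == f a) && (h b == h a))%:R * ((g c == g a) && (h c == h a))%:R /
  ((fiber p a)%:R * (fiber h a)%:R).
have -> : \sum_a rat a = \sum_b \sum_c \sum_a G a b c.
  under [RHS]eq_bigr do rewrite exchange_big /=.
  rewrite exchange_big /=; apply: eq_bigr => a _.
  rewrite /rat (fiberE q) (fiberE r) big_distrlr /= mulr_suml; apply: eq_bigr => b _.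
  by rewrite mulr_suml; apply: eq_bigr => c _.
(* The a that contribute form a single fibre of [p], whose size cancels the first factor of the
   denominator. *)
have inner b c : \sum_a G a b c <= (h c == h b)%:R / (fiber h b)%:R.
  case: (pickP (fun a => [&& f b == f a, h b == h a, g c == g a & h c == h a]));
    last first.
    move=> no; rewrite big1 ?divr_ge0 ?ler0n // => a _.
    by have := no a; rewrite /G -mulnb; do 4!case: (_ == _); rewrite ?mul0r ?mulr0 ?mul0r.
  move=> a0 /and4P[/eqP fb /eqP hb /eqP gc /eqP hc].
  rewrite hc hb eqxx.
  rewrite (eq_bigr (fun a =>
    (p a == p a0)%:R * ((fiber p a0)%:R * (fiber h b)%:R)^-1)); last first.
    move=> a _; rewrite /G fb hb gc hc [p a == _]eq_sym [in RHS]/p /joint !xpair_eqE.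
    case: eqP => fe; last by rewrite /= !mul0r.
    case: eqP => he; last by rewrite /= andbF !mul0r.
    case: eqP => ge; last by rewrite /= !(mul0r, mulr0).
    rewrite (@eq_fiber _ p a a0) ?(@eq_fiber _ h b a) ?hb //= ?mul1r //.
    by rewrite /p /joint fe he ge.
  by rewrite -mulr_suml -fiberE invfM mulrA divff ?gt_eqF //.
apply: le_trans (ler_sum _ (fun b _ => ler_sum _ (fun c _ => inner b c))) _.
under eq_bigr do rewrite -mulr_suml -fiberE divff ?gt_eqF //.
by rewrite sumr_const.
Qed.

Lemma entropy_subadd (S T : eqType) (f : Om -> S) (g : Om -> T) :
  entropy (joint f g) <= entropy f + entropy g.
Proof.
(* Submodularity is applied relative to a constant, whose entropy is 0. *)
pose h : Om -> unit := fun=> tt.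
have h0 : entropy h = 0.
  rewrite /entropy (eq_bigr (fun=> ln #|Om|%:R)).
    by rewrite sumr_const -[X in X / _]mulr_natr mulfK ?subrr // pnatr_eq0 -lt0n.
  by move=> a _; congr (ln _%:R); apply: eq_card => b; rewrite !inE.
have := entropy_submod f g h; rewrite h0 addr0 => le1.
apply: le_trans (le_trans le1 _).
  by apply: entropy_mono => a b; rewrite /joint => -[-> ->].
by apply: lerD; apply: entropy_mono => a b; rewrite /joint => ->.
Qed.

(** The form of submodularity behind every sumset inequality below: the joint variable of [f], [g],
    [h] has full entropy by injectivity, and [h] adds nothing to [g]. *)
Lemma entropy_function (S T U : eqType) (f : Om -> S) (g : Om -> T) (h : Om -> U) :
  injective (joint f g) -> (forall a b, g a = g b -> h a = h b) ->
  entropy h + ln #|Om|%:R <= entropy (joint f h) + entropy g.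
Proof.
move=> fgI gh; rewrite addrC.
have <- : entropy (joint f (joint g h)) = ln #|Om|%:R.
  by apply: entropy_inj => a b [ef eg _]; apply: fgI; rewrite /joint ef eg.
apply: le_trans (entropy_submod f g h) _; rewrite lerD2l.
by apply: entropy_mono => a b e; rewrite /joint e (gh _ _ e).
Qed.

(** Shannon entropy dominates the Renyi entropy of order 2; the sum of fibre sizes counts colliding
    pairs. *)
Lemma collision_entropy (T : eqType) (f : Om -> T) :
  ln (#|Om|%:R ^+ 2 / \sum_a (fiber f a)%:R) <= entropy f.
Proof.
have n0 : 0 < #|Om|%:R :> R by rewrite ltr0n.
have s0 : 0 < \sum_a (fiber f a)%:R :> R.
  rewrite -natr_sum ltr0n; case/card_gt0P: Om_gt0 => a _.
  by rewrite (bigD1 a) //= addn_gt0 fiber_gt0.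
have := @sum_ln_le (fun a => (fiber f a)%:R) ((\sum_a (fiber f a)%:R) / #|Om|%:R).
rewrite divfK ?gt_eqF // => /(_ _ _ (lexx _)) le1.
rewrite /entropy expr2 -mulrA lnM ?posrE ?divr_gt0 // lerD2l.
rewrite -[_ / \sum__ _]invf_div lnV ?posrE ?divr_gt0 // lerN2 ler_pdivrMr // mulrC.
by apply: le1; rewrite ?divr_gt0 // => a; rewrite ltr0n fiber_gt0.
Qed.

End Entropy.

(** An independent uniform coordinate multiplies all fibres by [#|E|]. This carries bounds from the
    larger sample space back to the pairs (w, x). *)
Lemma entropy_fst (R : realType) (D E : finType) (T : eqType) (f : D -> T) :
  (0 < #|D|)%N -> (0 < #|E|)%N ->
  entropy R (fun a : D * E => f a.1) = entropy R f.
Proof.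
move=> D0 E0.
have D1 : #|D|%:R != 0 :> R by rewrite pnatr_eq0 -lt0n.
have E1 : #|E|%:R != 0 :> R by rewrite pnatr_eq0 -lt0n.
have fibE (a : D * E) : fiber (fun a : D * E => f a.1) a = (fiber f a.1 * #|E|)%N.
  by rewrite /fiber -cardX; apply: eq_card => b; rewrite !inE andbT.
rewrite /entropy card_prod natrM lnM ?posrE ?ltr0n //.
under eq_bigr do rewrite fibE natrM lnM ?posrE ?ltr0n ?fiber_gt0 //.
rewrite big_split /= -(pair_bigA _ (fun d (_ : E) => ln (fiber f d)%:R)) /=.
rewrite sumr_const card_prod -[_ *+ (_ * _)]mulr_natr natrM.
rewrite (eq_bigr (fun i => ln (fiber f i)%:R * #|E|%:R)); last first.
  by move=> i _; rewrite sumr_const mulr_natr.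
rewrite -mulr_suml; field.
by rewrite D1 E1.
Qed.

(** * Quotients *)

Section Pivot.
Context (R : realType) (Fq : finFieldType) (V : lmodType Fq).
Context (W : {fset V}) (X : {set Fq}) (k1 k3 : R).
Hypotheses (W_neq0 : W != fset0) (X_gt0 : (0 < #|X|)%N).
Let lw : R := ln #|` W|%:R.
Let lx : R := ln #|X|%:R.
Hypothesis WXW_le : ln #|` sumset W (scale_set X W)|%:R <= k1 + lw.
Hypothesis WxW_le :
  forall x, x \in X -> ln #|` sumset W (dilate x W)|%:R <= k3 + lw.

(** [D] carries the pairs (w, x); the second factor of [Om] supplies two further independent samples
    y, z of W, so that all sums live on one uniform space. The parameters [k1] and [k3] stand for
    the logarithms of K1 and K3. *)
Notation D := (W * {x | x \in X})%type.
Notation Om := (D * (W * W))%type.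

Let w (a : Om) : V := val a.1.1.
Let x (a : Om) : Fq := val a.1.2.
Let y (a : Om) : V := val a.2.1.
Let z (a : Om) : V := val a.2.2.

Let W_gt0 : (0 < #|` W|)%N. Proof. by rewrite cardfs_gt0. Qed.

Let card_D : #|{: D}| = (#|` W| * #|X|)%N.
Proof. by rewrite card_prod cardfE card_sig. Qed.

Let D_gt0 : (0 < #|{: D}|)%N. Proof. by rewrite card_D muln_gt0 W_gt0. Qed.

Let card_Om : #|{: Om}| = (#|` W| * #|X| * (#|` W| * #|` W|))%N.
Proof. by rewrite card_prod card_D card_prod cardfE. Qed.

Let Om_gt0 : (0 < #|{: Om}|)%N. Proof. by rewrite card_Om !muln_gt0 W_gt0 X_gt0. Qed.

Let ln_Om : ln #|{: Om}|%:R = lw *+ 3 + lx.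
Proof.
by rewrite card_Om !natrM !lnM ?posrE ?mulr_gt0 ?ltr0n // -/lw -/lx; ring.
Qed.

Let Om_inj a b : w a = w b -> x a = x b -> y a = y b -> z a = z b -> a = b.
Proof.
case: a b => [[a1 a2] [a3 a4]] [[b1 b2] [b3 b4]].
by rewrite /w /x /y /z /= => /val_inj -> /val_inj -> /val_inj -> /val_inj ->.
Qed.

(** * Entropic sumset inequalities for independent samples of W and X *)

Let entropy_W (f : Om -> V) : (forall a, f a \in W) -> entropy R f <= lw.
Proof. exact: entropy_le_ln. Qed.

Let entropy_x : entropy R x <= lx.
Proof.
rewrite /lx cardE; apply: entropy_le_ln => // a.
by rewrite mem_enum; exact: valP.
Qed.

Let entropy_WxW c (f g : Om -> V) : c \in X ->
  (forall a, f a \in W) -> (forall a, g a \in W) ->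
  entropy R (fun a => f a + c *: g a) <= k3 + lw.
Proof.
move=> cX fW gW; apply: le_trans (WxW_le cX); apply: entropy_le_ln => // a.
by apply: in_imfset2 => //=; apply: in_imfset.
Qed.

Let entropy_WXW u (f : Om -> V) : u \in W -> (forall a, f a \in W) ->
  entropy R (fun a => f a + x a *: u) <= k1 + lw.
Proof.
move=> uW fW; apply: le_trans WXW_le; apply: entropy_le_ln => // a.
apply: in_imfset2 => //=; apply: in_imfset2 => //=; exact: valP.
Qed.

Let wW a : w a \in W. Proof. exact: valP. Qed.
Let yW a : y a \in W. Proof. exact: valP. Qed.
Let zW a : z a \in W. Proof. exact: valP. Qed.

(** With P = y + x u1 and Q = w + x u2, the sum is P + c Q, while for known x it is a translate of y
    + c w. Pairing (P, Q) with (x, z) determines the whole point of [Om], as [entropy_function]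
    requires. *)
Let entropy_combine c (u1 u2 : V) (p q r : R) :
  entropy R (fun a => y a + x a *: u1) <= p ->
  entropy R (fun a => w a + x a *: u2) <= q ->
  entropy R (fun a => y a + c *: w a) <= r ->
  entropy R (fun a => y a + (c *: (w a + x a *: u2) + x a *: u1)) <= p + q + r - lw *+ 2.
Proof.
set P := fun a => y a + _; set Q := fun a => _ + _; set N := fun a => _ + _.
set S := fun a => _ + (_ + _) => Pp Qq Nr.
have inj : injective (joint (joint x z) (joint P Q)).
  move=> a b; rewrite /joint /P /Q => -[ex ez]; rewrite ex => /addIr ey /addIr ew.
  exact: Om_inj.
have := entropy_function R Om_gt0 inj (h := S).
have PQS a b : joint P Q a = joint P Q b -> S a = S b.
  rewrite /joint => -[eP eQ].
  rewrite /S -/(Q a) -/(Q b) eQ [_ *: Q b + _]addrC addrA -/(P a) eP.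
  by rewrite /P -addrA [x b *: u1 + _]addrC.
move=> /(_ PQS); rewrite ln_Om => SUB.
have : entropy R (joint (joint x z) S) <= entropy R (joint (joint x z) N).
  apply: entropy_mono => a b; rewrite /joint /N /S => -[ex ez].
  rewrite !scalerDr !addrA ex ez => eN.
  by rewrite eN.
have := entropy_subadd R Om_gt0 (joint x z) N.
have := entropy_subadd R Om_gt0 x z.
have := entropy_subadd R Om_gt0 P Q.
have := entropy_x; have := entropy_W zW.
rewrite /lx /lw in SUB *; lra.
Qed.

Let entropy_add_translate c u1 u2 : c \in X -> u1 \in W -> u2 \in W ->
  entropy R (fun a => y a + (c *: (w a + x a *: u2) + x a *: u1)) <= k1 *+ 2 + k3 + lw.
Proof.
move=> cX u1W u2W.
have := entropy_combine (entropy_WXW u1W yW) (entropy_WXW u2W wW) (entropy_WxW cX yW wW).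
by move/le_trans; apply; rewrite /lw; lra.
Qed.

Let entropy_dilate c u : c \in X -> u \in W ->
  entropy R (fun a => y a + (c *: w a + x a *: u)) <= k1 + k3 + lw.
Proof.
move=> cX uW.
(* Taking u2 = 0 replaces one bound k1 + lw by lw. *)
have w0 : entropy R (fun a => w a + x a *: 0) <= lw.
  by apply: entropy_W => a; rewrite scaler0 addr0.
have := entropy_combine (entropy_WXW uW yW) w0 (entropy_WxW cX yW wW).
under [X in entropy R X]funext do rewrite scaler0 addr0.
by move/le_trans; apply; rewrite /lw; lra.
Qed.

(** Entropic Pluennecke inequality: H(y + A + B) + H(y) <= H(y + A) + H(y + B) for A = c w and B = s
    z, independent of each other and of y. *)
Let entropy_double_dilate c s : c \in X -> s \in X ->
  entropy R (fun a => y a + c *: w a + s *: z a) <= k3 *+ 2 + lw.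
Proof.
move=> cX sX; set N := fun a => y a + c *: w a; set P := fun a => y a + s *: z a.
set T := fun a => _ + _ + _.
have inj : injective (joint (joint x z) (joint P w)).
  move=> a b; rewrite /joint /P => -[ex ez]; rewrite ez => /addIr ey ew.
  exact: Om_inj.
have PT a b : joint P w a = joint P w b -> T a = T b.
  by rewrite /joint => -[eP ew]; rewrite /T addrAC -/(P a) eP ew addrAC.
have SUB := entropy_function R Om_gt0 inj PT; rewrite ln_Om in SUB.
have : entropy R (joint (joint x z) T) <= entropy R (joint (joint x z) N).
  apply: entropy_mono => a b; rewrite /joint /N /T => -[ex ez] eN.
  by rewrite eN ex ez.
have := entropy_subadd R Om_gt0 (joint x z) N.
have := entropy_subadd R Om_gt0 x z.
have := entropy_subadd R Om_gt0 P w.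
have := entropy_x; have := entropy_W zW; have := entropy_W wW.
have := entropy_WxW cX yW wW; have := entropy_WxW sX yW zW.
rewrite -/N -/P /lx /lw in SUB *; lra.
Qed.

(* Adding the independent term s z does not decrease the entropy and turns
   x s u into s (z + x u), to which the bound on W + XW applies. *)
Let entropy_scale c s u : c \in X -> s \in X -> u \in W ->
  entropy R (fun a => y a + (c *: w a + (x a * s) *: u)) <= k1 + k3 *+ 2 + lw.
Proof.
move=> cX sX uW; set S := fun a => _ + (_ + _).
pose T := fun a => y a + c *: w a + s *: z a.
pose Q := fun a => z a + x a *: u.
pose S' := fun a => S a + s *: z a.
have inj : injective (joint x (joint (joint y w) Q)).
  move=> a b; rewrite /joint /Q => -[ex ey ew]; rewrite ex => /addIr ez.
  exact: Om_inj.
have QS a b : joint (joint y w) Q a = joint (joint y w) Q b -> S' a = S' b.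
  rewrite /joint => -[ey ew eQ].
  have SE d : S' d = y d + c *: w d + s *: Q d.
    by rewrite /S' /S /Q scalerDr scalerA [s * _]mulrC !addrA [LHS]addrAC.
  by rewrite !SE ey ew eQ.
have SUB1 := entropy_function R Om_gt0 inj QS; rewrite ln_Om in SUB1.
(* For known x, [S'] is the translate of [T] by (x s) u. *)
have T1 : entropy R (joint x S') <= entropy R (joint x T).
  apply: entropy_mono => a b; rewrite /joint /T /S' /S => -[ex eT].
  by rewrite !addrA ![_ + _ + _ *: u + _]addrAC eT ex.
(* [S] depends on y, w, x only, hence is independent of z; this gives H(S) <= H(S + s z). *)
have inj2 : injective (joint z (joint (joint y w) x)).
  by move=> a b; rewrite /joint => -[ez ey ew ex]; exact: Om_inj.
have SS a b : joint (joint y w) x a = joint (joint y w) x b -> S a = S b.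
  by rewrite /joint /S => -[-> -> ->].
have SUB2 := entropy_function R Om_gt0 inj2 SS; rewrite ln_Om in SUB2.
have T2 : entropy R (joint z S) <= entropy R (joint z S').
  by apply: entropy_mono => a b; rewrite /joint /S' => -[->] /addIr ->.
have := entropy_subadd R Om_gt0 x T.
have := entropy_subadd R Om_gt0 z S'.
have := entropy_subadd R Om_gt0 (joint y w) x.
have := entropy_subadd R Om_gt0 (joint y w) Q.
have := entropy_subadd R Om_gt0 y w.
have := entropy_double_dilate cX sX; rewrite -/T.
have := entropy_WXW uW zW; rewrite -/Q.
have := entropy_x; have := entropy_W zW; have := entropy_W wW; have := entropy_W yW.
rewrite /lx /lw in SUB1 SUB2 *; lra.
Qed.

(* Ruzsa's triangle inequality; A and C may depend on each other. *)
Let entropy_triangle (A C : Om -> V) (p : R) :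
  (forall a b, w a = w b -> x a = x b -> A a = A b) ->
  (forall a b, w a = w b -> x a = x b -> C a = C b) ->
  entropy R (fun a => y a + A a) <= p -> entropy R (fun a => y a + C a) <= p ->
  entropy R (fun a => A a - C a) <= p *+ 2 - lw.
Proof.
set S1 := fun a => y a + A a; set S2 := fun a => y a + C a.
set U := fun a => _ - _ => AE CE S1p S2p.
(* [A] depends on w and x only, so subtracting it from [S1] recovers y. *)
have inj : injective (joint S1 (joint (joint w x) z)).
  move=> a b; rewrite /joint /S1 => -[eS ew ex ez].
  by move: eS; rewrite (AE a b) // => /addIr ey; exact: Om_inj.
have UE a b : joint (joint w x) z a = joint (joint w x) z b -> U a = U b.
  by rewrite /joint => -[ew ex _]; rewrite /U (AE a b) // (CE a b).
have SUB := entropy_function R Om_gt0 inj UE; rewrite ln_Om in SUB.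
have : entropy R (joint S1 U) <= entropy R (joint S1 S2).
  apply: entropy_mono => a b; rewrite /joint => -[e1 e2].
  have US d : U d = S1 d - S2 d by rewrite /U /S1 /S2 opprD addrACA subrr add0r.
  by rewrite !US e1 e2.
have := entropy_subadd R Om_gt0 S1 S2.
have := entropy_subadd R Om_gt0 (joint w x) z.
have := entropy_subadd R Om_gt0 w x.
have := entropy_x; have := entropy_W zW; have := entropy_W wW.
rewrite /lx /lw in SUB *; lra.
Qed.

(** * Entropy of w + x v for quotients v *)

Definition line (v : V) (d : D) : V := val d.1 + val d.2 *: v.

(** Scaling by t <> 0 preserves entropy. If (x1 - x2) v = w1 - w2, then t = x1 - x2 gives t (w + x
    v) = (x1 w + x w1) - (x2 w + x w2): v is eliminated, and the triangle inequality applies to the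
    two brackets. *)
Let entropy_line_le v (t : Fq) (A C : Om -> V) (p : R) : t != 0 ->
  (forall a, t *: (w a + x a *: v) = A a - C a) ->
  (forall a b, w a = w b -> x a = x b -> A a = A b) ->
  (forall a b, w a = w b -> x a = x b -> C a = C b) ->
  entropy R (fun a => y a + A a) <= p -> entropy R (fun a => y a + C a) <= p ->
  entropy R (line v) <= p *+ 2 - lw.
Proof.
move=> t0 tE AE CE Ap Cp; apply: le_trans (entropy_triangle AE CE Ap Cp).
rewrite -(entropy_fst R (E := (W * W)%type) _ D_gt0); last first.
  by rewrite card_prod -cardfE muln_gt0 W_gt0.
by apply: entropy_mono => a b; rewrite -!tE => /(scalerI t0).
Qed.

Definition quotient (v : V) : Prop :=
  exists w1 w2 : V, exists x1 x2 : Fq,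
  [/\ w1 \in W, w2 \in W, x1 \in X, x2 \in X &
      x1 != x2 /\ (x1 - x2) *: v = w1 - w2].

Lemma entropy_quotient v : quotient v ->
  entropy R (line v) <= k1 *+ 2 + k3 *+ 2 + lw.
Proof.
case=> w1 [w2 [x1 [x2 [w1W w2W x1X x2X [x12 ve]]]]].
apply: le_trans (entropy_line_le (t := x1 - x2)
  _ _ _ _ (entropy_dilate x1X w1W) (entropy_dilate x2X w2W)) _.
- by rewrite subr_eq0.
- by move=> a; rewrite scalerDr scalerA mulrC -scalerA ve scalerBl scalerBr opprD addrACA.
- by move=> a b -> ->.
- by move=> a b -> ->.
- by rewrite /lw; lra.
Qed.

Lemma entropy_quotient_add v u : quotient v -> u \in W ->
  entropy R (line (v + u)) <= k1 *+ 4 + k3 *+ 2 + lw.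
Proof.
case=> w1 [w2 [x1 [x2 [w1W w2W x1X x2X [x12 ve]]]]] uW.
apply: le_trans (entropy_line_le (t := x1 - x2)
  _ _ _ _ (entropy_add_translate x1X w1W uW) (entropy_add_translate x2X w2W uW)) _.
- by rewrite subr_eq0.
(* The term x u stays with w, which yields x1 (w + x u) + x w1, the shape bounded in
   [entropy_add_translate]. *)
- move=> a; rewrite [v + u]addrC [_ *: (u + v)]scalerDr addrA [LHS]scalerDr.
  have -> : (x1 - x2) *: (x a *: v) = x a *: (w1 - w2).
    by rewrite scalerA mulrC -scalerA ve.
  by rewrite scalerBl scalerBr opprD addrACA.
- by move=> a b -> ->.
- by move=> a b -> ->.
- by rewrite /lw; lra.
Qed.

Lemma entropy_quotient_scale v s : quotient v -> s \in X ->
  entropy R (line (s *: v)) <= k1 *+ 2 + k3 *+ 4 + lw.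
Proof.
case=> w1 [w2 [x1 [x2 [w1W w2W x1X x2X [x12 ve]]]]] sX.
apply: le_trans (entropy_line_le (t := x1 - x2)
  _ _ _ _ (entropy_scale x1X sX w1W) (entropy_scale x2X sX w2W)) _.
- by rewrite subr_eq0.
- move=> a; rewrite scalerDr.
  have -> : (x1 - x2) *: (x a *: (s *: v)) = (x a * s) *: (w1 - w2).
    by rewrite -ve !scalerA; congr (_ *: _); ring.
  by rewrite scalerBl scalerBr opprD addrACA.
- by move=> a b -> ->.
- by move=> a b -> ->.
- by rewrite /lw; lra.
Qed.

Lemma quotient_of_entropy v : entropy R (line v) < lx + lw -> quotient v.
Proof.
move=> lt; apply: contrapT => nq; move: lt; apply/negP; rewrite -leNgt.
rewrite entropy_inj ?card_D ?natrM ?lnM ?posrE ?ltr0n // 1?addrC //.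
move=> -[w1 [x1 x1X]] [w2 [x2 x2X]]; rewrite /line /= => e.
have ex : x1 = x2.
  apply/eqP/negPn/negP => x12; apply: nq; exists (val w2), (val w1), x1, x2.
  split; [exact: valP|exact: valP|by []|by []|split=> //].
  by apply/eqP; rewrite scalerBl subr_eq addrAC eq_sym subr_eq -e addrC.
move: x1X x2X e; rewrite ex => h1 h2 /addIr/val_inj ->.
by congr (_, _); exact: val_inj.
Qed.
(* Two points (w, x), (w', x') with x <> x' collide for at most one v. *)
Lemma energy_le (U : {fset V}) :
  (\sum_(v <- U) \sum_d fiber (line v) d <=
   #|` W| * #|X| * (#|` U| + #|` W| * #|X|.-1))%N.
Proof.
have fibE v d : fiber (line v) d = (\sum_e (line v e == line v d))%N.
  by rewrite /fiber -sum1_card big_mkcond; apply: eq_bigr => e _; rewrite inE; case: eqP.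
under eq_bigr do under eq_bigr do rewrite fibE.
rewrite exchange_big /= -card_D -sum_nat_const; apply: leq_sum => d _.
rewrite exchange_big /=.
(* For fixed d, the point e = d collides for every v, another e with the same x for none, and each
   remaining e for at most one v. *)
apply: (@leq_trans (\sum_(e : D) ((e == d) * #|` U| + (e.2 != d.2)))%N).
  apply: leq_sum => e _; have [e2|e2] := eqVneq e.2 d.2.
    rewrite addn0; have [_|ed] := eqVneq e d.
      by rewrite mul1n card_fset_sum1; apply: leq_sum => v _; exact: leq_b1.
    rewrite big1 // => v _; apply/eqP; rewrite eqb0; apply: contra ed => /eqP.
    rewrite /line e2 => /addIr/val_inj e1.
    by apply/eqP; case: e d e1 e2 => [? ?] [? ?] /= -> ->.
  have e20 : val e.2 - val d.2 != 0 by rewrite subr_eq0 val_eqE.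
  pose v0 := (val e.2 - val d.2)^-1 *: (val d.1 - val e.1).
  apply: (@leq_trans (count_mem v0 U)).
    rewrite -sum1_count [leqRHS]big_mkcond; apply: leq_sum => v _.
    case: eqP => //=; rewrite /line => le; case: eqP => // -[]; apply: (scalerI e20).
    rewrite scalerA divff // scale1r scalerBl.
    by apply/eqP; rewrite subr_eq addrAC eq_sym subr_eq -le addrC.
  by rewrite count_uniq_mem ?fset_uniq // addn1 (leq_trans (leq_b1 _)).
rewrite big_split /= -big_distrl /=.
rewrite (bigD1 d) //= eqxx big1 ?addn0; last by move=> e /negbTE ->.
rewrite mul1n leq_add2l cardfE.
rewrite -big_mkcond sum1_card; apply: (@leq_trans #|predX predT (predC1 d.2)|).
  by apply: subset_leq_card; apply/subsetP => e; rewrite !inE.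
by rewrite cardX cardC1 card_sig.
Qed.

Lemma card_quotients_le (U : {fset V}) (M : R) :
  0 < M -> k1 *+ 2 + k3 *+ 2 = ln M -> (forall v, v \in U -> quotient v) ->
  #|` U|%:R * #|X|%:R <= M * (#|` U|%:R + #|` W|%:R * (#|X|%:R - 1)).
Proof.
move=> M0 kM UQ.
have W0 : 0 < #|` W|%:R :> R by rewrite ltr0n.
have X0 : 0 < #|X|%:R :> R by rewrite ltr0n.
(* Exponentiating [collision_entropy] and [entropy_quotient], with domain size |W||X|, bounds the
   collision number below; one factor |W| cancels. *)
have energy_ge v : v \in U ->
    (#|` W|%:R * #|X|%:R ^+ 2) <= M * (\sum_d fiber (line v) d)%:R.
  move=> vU; have E0 : (0 < \sum_d fiber (line v) d)%N.
    case/card_gt0P: D_gt0 => d _.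
    by rewrite (bigD1 d) //= addn_gt0 fiber_gt0.
  have := le_trans (collision_entropy R D_gt0 (line v)) (entropy_quotient (UQ _ vU)).
  rewrite -natr_sum kM /lw -lnM ?posrE // ler_ln ?posrE;
    rewrite ?mulr_gt0 ?invr_gt0 ?exprn_gt0 ?ltr0n //.
  rewrite ler_pdivrMr ?ltr0n // card_D natrM => le1.
  by rewrite -(ler_pM2l W0); lra.
have : \sum_(v <- U) (#|` W|%:R * #|X|%:R ^+ 2) <=
       \sum_(v <- U) M * (\sum_d fiber (line v) d)%:R.
  by rewrite big_seq [leRHS]big_seq; apply: ler_sum => v; exact: energy_ge.
rewrite -[leRHS]mulr_sumr -natr_sum big_const_seq count_predT iter_addr addr0.
rewrite -mulr_natr => le1.
have := energy_le U; rewrite -(ler_nat R) -(ler_pM2l M0) => /(le_trans le1).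
rewrite !natrM natrD natrM -subn1 natrB // => le2.
(* Lower and upper bounds on the total collision number share the factor |W||X|. *)
rewrite -(ler_pM2l (mulr_gt0 W0 X0)).
lra.
Qed.
End Pivot.

(** * Sumset sizes, closure in finite fields, and induction over the span *)

Lemma card_sumset_ge (V : zmodType) (S T : {fset V}) :
  T != fset0 -> (#|` S| <= #|` sumset S T|)%N.
Proof.
case/fset0Pn => t tT.
have <- : #|` [fset s + t | s in S]| = #|` S|.
  by rewrite card_imfset //=; exact: addIr.
apply: fsubset_leq_card; apply/fsubsetP => v /imfsetP[s /= sS ->].
by apply: in_imfset2.
Qed.

(** By finiteness the iterates of adding c return to 0, and the last one before the return is -c, a
    sum of copies of c. *)
Lemma finField_opp_closed (K : finFieldType) (S : {pred K}) c :
  0 \in S -> {in S &, forall a b, a + b \in S} -> c \in S -> - c \in S.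
Proof.
move=> S0 SD Sc; have := iter_order (addrI c) 0.
rewrite -orderSpred iterS => /eqP; rewrite addrC addr_eq0 => /eqP <-.
by elim: _.-1 => //= n IH; apply: (SD _).
Qed.

(** Likewise the inverse of a nonzero c is a power of c; for c = 0 the convention 0^-1 = 0
    applies. *)
Lemma finField_inv_closed (K : finFieldType) (S : {pred K}) c :
  1 \in S -> {in S &, forall a b, a * b \in S} -> c \in S -> c^-1 \in S.
Proof.
move=> S1 SM; have [->|c0 Sc] := eqVneq c 0; first by rewrite invr0.
have := iter_order (mulfI c0) 1.
rewrite -orderSpred iterS => /(canRL (mulKf c0)); rewrite mulr1 => <-.
by elim: _.-1 => //= n IH; apply: (SM _).
Qed.

(** Reduces closure under the whole field F to the two operations that entropy controls. The
    coefficients c for which adding c u preserves P, for all u in W, are shown to include F. *)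
Lemma span_ind (K : finFieldType) (V : lmodType K) (W : {fset V}) (X : {set K})
    (P : V -> Prop) :
  P 0 -> (forall v u, P v -> u \in W -> P (v + u)) ->
  (forall v s, P v -> s \in X -> P (s *: v)) ->
  forall v, v \in span_over (generated_subfield X) W -> P v.
Proof.
move=> P0 PD PZ.
pose S : {set K} := [set c | `[< forall v u, P v -> u \in W -> P (v + c *: u) >]].
have SP c : c \in S -> forall v u, P v -> u \in W -> P (v + c *: u).
  by rewrite inE => /asboolP.
have S0 : 0 \in S by rewrite inE; apply/asboolP => v u Pv _; rewrite scale0r addr0.
have S1 : 1 \in S by rewrite inE; apply/asboolP => v u Pv uW; rewrite scale1r; apply: PD.
have SD : {in S &, forall a b, a + b \in S}.
  move=> a b aS bS; rewrite inE; apply/asboolP => v u Pv uW.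
  by rewrite scalerDl addrA; apply: (SP _) => //; apply: (SP _).
have SX s c : s \in X -> c \in S -> s * c \in S.
  move=> sX cS; have [->|s0] := eqVneq s 0; first by rewrite mul0r.
  rewrite inE; apply/asboolP => v u Pv uW.
  (* P passes to s^-1 v because s^-1 is a power of s; then c u is added and the result is scaled
     back by s. *)
  have -> : v + (s * c) *: u = s *: (s^-1 *: v + c *: u).
    by rewrite scalerDr !scalerA divff // scale1r.
  apply: (PZ _) => //; apply: (SP _) => //.
  have := iter_order (mulfI s0) 1.
  rewrite -orderSpred iterS => /(canRL (mulKf s0)); rewrite mulr1 => <-.
  elim: _.-1 => [|n IH] /=; first by rewrite scale1r.
  by rewrite -scalerA; apply: (PZ _).
(* S is an additive group, so its multiplier ring G is a field containing X. *)
pose G : {set K} := [set a | [forall c in S, a * c \in S]].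
have GP a c : a \in G -> c \in S -> a * c \in S.
  by rewrite inE => /forall_inP; apply.
have GM : {in G &, forall a b, a * b \in G}.
  move=> a b aG bG; rewrite inE; apply/forall_inP => c cS.
  by rewrite -mulrA; apply: (GP _) => //; apply: (GP _).
have G1 : 1 \in G by rewrite inE; apply/forall_inP => c cS; rewrite mul1r.
have G0 : 0 \in G by rewrite inE; apply/forall_inP => c cS; rewrite mul0r.
have GD : {in G &, forall a b, a + b \in G}.
  move=> a b aG bG; rewrite inE; apply/forall_inP => c cS.
  by rewrite mulrDl; apply: (SD _); apply: (GP _).
have FG a : a \in generated_subfield X -> a \in G.
  move/bigcapP; apply; apply/andP; split.
    by apply/subsetP => s sX; rewrite inE; apply/forall_inP => c; apply: SX.
  apply/asboolP; split=> // a1 b1 a1G b1G.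
    by apply: (GD _) => //; apply: finField_opp_closed.
  by apply: (GM _) => //; apply: finField_inv_closed.
move=> v /imfsetP[c /= /ffun_onP cF ->].
elim/big_rec: _ => // w u _ Pu; rewrite addrC; apply: (SP (c w)) => //.
(* The coefficient lies in F, hence in [G], and [G] maps 1, an element of [S], into [S]. *)
by rewrite -[c w]mulr1; apply: (GP _) => //; apply: FG.
Qed.

(** * From quotients to the bound on the span *)

Theorem theoremD (R : realType) (Fq : finFieldType) (V : lmodType Fq)
    (W : {fset V}) (X : {set Fq}) (K1 K2 K3 : R) :
  W != fset0 ->
  #|` sumset W (scale_set X W)|%:R <= K1 * #|` W|%:R ->
  #|` sumset W W|%:R <= K2 * #|` W|%:R ->
  (forall x : Fq, x \in X -> #|` sumset W (dilate x W)|%:R <= K3 * #|` W|%:R) ->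
  K1 ^+ 4 * K2 * K3 ^+ 4 < #|X|%:R ->
  #|` W|%:R >=
    1 / (2 * K1 ^+ 2 * K3 ^+ 2) * #|` span_over (generated_subfield X) W|%:R.
Proof.
move=> Wn0 hK1 hK2 hK3 hX.
have W0 : 0 < #|` W|%:R :> R by rewrite ltr0n cardfs_gt0.
have ge1 (T : {fset V}) (K : R) :
    T != fset0 -> #|` sumset W T|%:R <= K * #|` W|%:R -> 1 <= K.
  move=> T0 /(le_trans _)-/(_ #|` W|%:R); rewrite ler_nat card_sumset_ge // => /(_ isT).
  by rewrite -{1}[#|` W|%:R]mul1r ler_pM2r.
have K2ge1 : 1 <= K2 by apply: ge1 hK2.
have X0 : (0 < #|X|)%N.
  (* The signs of K1 and K3 are still unknown here, but their even powers are nonnegative. *)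
  rewrite lt0n; apply: contraTneq hX => ->; rewrite -leNgt.
  apply: mulr_ge0; last exact: exprn_even_ge0.
  by apply: mulr_ge0; [exact: exprn_even_ge0 | exact: le_trans K2ge1].
have [x xX] : exists x, x \in X by apply/set0Pn; rewrite -card_gt0.
have [u uW] := fset0Pn _ Wn0.
have K3ge1 : 1 <= K3.
  apply: ge1 (hK3 x xX); apply/fset0Pn; exists (x *: u).
  by apply: in_imfset.
have K1ge1 : 1 <= K1.
  by apply: ge1 hK1; apply/fset0Pn; exists (x *: u); apply: in_imfset2.
have ln_le (n : nat) (K : R) : (0 < n)%N -> 1 <= K -> n%:R <= K * #|` W|%:R ->
    ln n%:R <= ln K + ln #|` W|%:R.
  move=> n0 K1' le1; have K0 : 0 < K by apply: lt_le_trans K1'.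
  by rewrite -lnM ?posrE // ler_ln ?posrE ?mulr_gt0 ?ltr0n ?cardfs_gt0.
have sumset_gt0 (T : {fset V}) : T != fset0 -> (0 < #|` sumset W T|)%N.
  by move=> T0; apply: leq_trans (card_sumset_ge _ T0); rewrite cardfs_gt0.
have k1 : ln #|` sumset W (scale_set X W)|%:R <= ln K1 + ln #|` W|%:R.
  apply: ln_le => //; apply: sumset_gt0; apply/fset0Pn; exists (x *: u).
  exact: in_imfset2.
have k3 s : s \in X -> ln #|` sumset W (dilate s W)|%:R <= ln K3 + ln #|` W|%:R.
  move=> sX; apply: ln_le => //; last exact: hK3.
  by apply: sumset_gt0; apply/fset0Pn; exists (s *: u); apply: in_imfset.
have K10 : 0 < K1 by apply: lt_le_trans K1ge1.
have K20 : 0 < K2 by apply: lt_le_trans K2ge1.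
have K30 : 0 < K3 by apply: lt_le_trans K3ge1.
have XR : 0 < #|X|%:R :> R by rewrite ltr0n.
(* Since K2 >= 1, the size condition gives K1^4 K3^4 < |X|; this dominates both K1^4 K3^2 and K1^2
   K3^4, the losses in the two closure steps. *)
have lnX : ln K1 *+ 4 + ln K3 *+ 4 < ln #|X|%:R.
  apply: le_lt_trans (_ : ln (K1 ^+ 4 * K2 * K3 ^+ 4) < _); last first.
    by rewrite ltr_ln ?posrE ?mulr_gt0 ?exprn_gt0.
  rewrite lnM ?posrE ?mulr_gt0 ?exprn_gt0 // lnM ?posrE ?exprn_gt0 // !lnXn //.
  by have := ln_ge0 K2ge1; lra.
have ln1 := ln_ge0 K1ge1; have ln3 := ln_ge0 K3ge1.
have quot := quotient_of_entropy Wn0 X0 (R := R).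
have Q v : v \in span_over (generated_subfield X) W -> quotient W X v.
  apply: span_ind => {v} [|v s Qv sW|v s Qv sX].
  (* For 0 to be a quotient, X must have two distinct elements; all three constants being at least 1
     forces |X| > 1. *)
  - have /card_gt1P[x1 [x2 [x1X x2X x12]]] : (1 < #|X|)%N.
      rewrite -(ltr_nat R); apply: le_lt_trans hX.
      by rewrite !mulr_ege1 ?exprn_ege1.
    by exists u, u, x1, x2; split=> //; rewrite scaler0 subrr.
  - apply: quot; apply: le_lt_trans (entropy_quotient_add Wn0 X0 k1 k3 Qv sW) _.
    by rewrite ltrD2r; lra.
  - apply: quot; apply: le_lt_trans (entropy_quotient_scale Wn0 X0 k1 k3 Qv sX) _.
    by rewrite ltrD2r; lra.
pose M := K1 ^+ 2 * K3 ^+ 2.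
have Mge1 : 1 <= M by rewrite mulr_ege1 ?exprn_ege1.
have M0 : 0 < M by apply: lt_le_trans Mge1.
have kM : ln K1 *+ 2 + ln K3 *+ 2 = ln M.
  by rewrite /M lnM ?posrE ?exprn_gt0 // !lnXn.
have := card_quotients_le Wn0 X0 k1 k3 M0 kM Q.
set U := #|` _|%:R; set w := #|` W|%:R; set q := #|X|%:R => le1.
have qM : M ^+ 2 < q.
  apply: le_lt_trans hX; rewrite (_ : _ * _ = K2 * M ^+ 2); last by rewrite /M; ring.
  by rewrite ler_peMl // exprn_ge0 // ltW.
have qM2 : M *+ 2 - 1 < q.
  apply: le_lt_trans qM.
  by rewrite -subr_ge0 (_ : _ - _ = (M - 1) ^+ 2) ?sqr_ge0 //; ring.
have qMpos : 0 < q - M by lra.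
rewrite mul1r mulrC ler_pdivrMr ?mulr_gt0 //.
rewrite -(ler_pM2r qMpos).
(* The chain is U (q - M) <= M w (q - 1) <= 2 M w (q - M), the last inequality being q >= 2 M -
   1. *)
apply: (@le_trans _ _ (M * w * (q - 1))).
  by rewrite mulrBr; move: le1; rewrite mulrDr [U * M]mulrC mulrA; lra.
rewrite [leRHS](_ : _ = M * w * (2 * (q - M))); last by rewrite /M; ring.
by rewrite ler_pM2l ?mulr_gt0 //; lra.
Qed.
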